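(* Let $F_d$ be the free group of rank $d$ with free basis $a_1,\dots,a_d$, acting on its Cayley tree $\mathcal T$ with respect to this basis. Let $\Gamma \leq F_d$ be a finitely generated subgroup, let $O \subset \mathrm{Sub}(F_d)$ be a neighborhood of $\Gamma$ in the Chabauty space, and let $\epsilon > 0$. Then there exists a boomerang subgroup $\Delta \in \mathrm{Sub}(F_d)$ with $\Delta \in O$ and $\delta(\Gamma) \leq \delta(\Delta) \leq \delta(\Gamma) + \epsilon$.
   Context: For a countable group $G$, $\mathrm{Sub}(G)$ is the set of subgroups of $G$ with the topology induced from the product topology via $\mathrm{Sub}(G) \subset \{0,1\}^G$ (the Chabauty space); $G$ acts on it by conjugation. A subgroup $\Delta \in \mathrm{Sub}(G)$ is a boomerang subgroup if for every $g \in G$ there is a sequence $n_k \to \infty$ with $\lim_{k\to\infty} g^{n_k}\Delta g^{-n_k} = \Delta$ in $\mathrm{Sub}(G)$. For $\Gamma \leq F_d$, $|g|$ denotes word length of $g\in F_d$ (the distance from $1$ to $g$ in $\mathcal T$), and the critical exponent is $\delta(\Gamma) = \inf\{ s>0 \mid \sum_{\gamma\in\Gamma} e^{-s|\gamma|} < \infty\}$; equivalently $\delta(\Gamma) = \lim_{R\to\infty} \frac{\ln c_\Gamma(R)}{R}$ where $c_\Gamma(R) = |\{\gamma\in\Gamma \mid |\gamma|\le R\}|$. *)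

(* Defs.v *)
From HB Require Import structures.
From mathcomp Require Import all_boot all_order all_algebra.
From mathcomp Require Import all_classical all_reals all_analysis.
Set Implicit Arguments. Unset Strict Implicit. Unset Printing Implicit Defensive.
Import Order.TTheory GRing.Theory Num.Theory.
Local Open Scope classical_set_scope.
Local Open Scope ring_scope.

(* Free group F_d on the basis a_1..a_d. A letter (i, true) is a_i,
   (i, false) is a_i^{-1}. Elements of F_d are the reduced words. *)
Definition letter (d : nat) := ('I_d * bool)%type.
Definition word (d : nat) := seq (letter d).

Definition linv d (x : letter d) : letter d := (x.1, ~~ x.2).

Fixpoint reduced d (w : word d) : bool :=
  match w with
  | x :: ((y :: _) as w') => (y != linv x) && reduced w'
  | _ => true
  end.

Definition push d (x : letter d) (s : word d) : word d :=
  match s with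
  | y :: s' => if y == linv x then s' else x :: s
  | [::] => [:: x]
  end.

Definition fmul d (u v : word d) : word d := foldr (@push d) v u.
Definition finv d (w : word d) : word d := rev (map (@linv d) w).
Fixpoint fpow d (g : word d) (n : nat) : word d :=
  if n is n'.+1 then fmul g (fpow g n') else [::].

(* word length |g| = distance from 1 to g in the Cayley tree *)
Definition wlen d (g : word d) : nat := size g.

Definition is_subgroup d (H : set (word d)) : Prop :=
  (forall x, H x -> reduced x) /\ H [::] /\
  (forall x y, H x -> H y -> H (fmul x y)) /\
  (forall x, H x -> H (finv x)).

Definition fin_gen d (G : set (word d)) : Prop :=
  exists S : seq (word d), all (@reduced d) S /\
    forall x, G x <-> (forall H, is_subgroup H -> (forall s, s \in S -> H s) -> H x).

Definition conjset d (g : word d) (H : set (word d)) : set (word d) :=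
  [set x | H (fmul (fmul (finv g) x) g)].

Definition chab_cvg d (Hs : nat -> set (word d)) (H : set (word d)) : Prop :=
  forall g, reduced g -> exists N, forall k, (N <= k)%N -> (Hs k g <-> H g).

(* O is a neighborhood of G in Sub(F_d) for the product topology:
   O contains a basic open set (agreement on a finite set of elements) *)
Definition chab_nbhd d (G : set (word d)) (O : set (set (word d))) : Prop :=
  exists S : seq (word d), forall H, is_subgroup H ->
    (forall g, g \in S -> (H g <-> G g)) -> O H.

Definition boomerang d (D : set (word d)) : Prop :=
  is_subgroup D /\
  forall g, reduced g -> exists n : nat -> nat,
    (forall N, exists K, forall k, (K <= k)%N -> (N <= n k)%N) /\
    chab_cvg (fun k => conjset (fpow g (n k)) D) D.

Definition critexp (R : realType) d (G : set (word d)) : \bar R :=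
  ereal_inf [set s%:E | s in
    [set s : R | 0 < s /\
       (\esum_(g in G) (expR (- s * (wlen g)%:R))%:E < +oo)%E]].

(* Main.v *)
Require Import Defs.
From mathcomp Require Import all_boot all_order all_algebra.
From mathcomp Require Import all_classical all_reals all_analysis.
From mathcomp Require Import ring lra.
Import Order.TTheory GRing.Theory Num.Theory.
(* [finv] must denote the inverse in the free group, not [fingraph.finv]. *)
Import Defs.
Set Implicit Arguments. Unset Strict Implicit. Unset Printing Implicit Defensive.
Local Open Scope classical_set_scope.
Local Open Scope ring_scope.

(* Let hull H be the set of prefixes of elements of H: it is the subtree of the
   Cayley tree spanned by H, it is H-invariant, and it is finite modulo H when H
   is finitely generated.  If no positive power of g lies in H, then the rays
   towards the two ends of g therefore leave hull H, so for large n
   g^-n = u w v^-1 where u and v stay bounded, u and v are the last points of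
   the two rays in hull H, and w is long.  In K = <H, g^-n H g^n> every product
   alternating between the two factors then becomes, after absorbing u and v, a
   reduced concatenation in which each passage costs |w|; hence the total weight
   e^(-s|x|) of the x in K \ H is as small as one likes, for any s at which the
   series of H converges.  The same holds for g^n K g^-n \ H, so g^n K g^-n and
   H agree on a large ball.  If some g^m lies in H, take K = H and n a multiple
   of m.  Starting from Gamma and treating every g infinitely often, the union of
   the resulting chain is a boomerang subgroup that agrees with Gamma on a given
   ball, and its series converges at an s chosen below delta(Gamma) + eps. *)

(** * Reduced words *)

Section FreeGroup.
Variable d : nat.
Implicit Types (x y z : letter d) (u v w p q r g h t c : word d).

Lemma linvK : involutive (@linv d).
Proof. by case=> i b; rewrite /linv /= negbK. Qed.

Lemma linv_neq x : linv x != x.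
Proof. by case: x => i [] //=; rewrite /linv xpair_eqE eqxx. Qed.

Lemma eq_linv x y : (y == linv x) = (x == linv y).
Proof. by rewrite -{1}(linvK y) (inj_eq (inv_inj linvK)) eq_sym. Qed.

Lemma reduced_cons x y w :
  reduced (x :: y :: w) = (y != linv x) && reduced (y :: w).
Proof. by []. Qed.

Lemma reduced_cat_cons u x v :
  reduced (u ++ x :: v) = reduced (rcons u x) && reduced (x :: v).
Proof.
elim: u => [|y [|z u] IH] //=; first by rewrite andbT.
by move: IH => /= ->; rewrite andbA.
Qed.

Lemma reduced_rcons2 u x y :
  reduced (rcons (rcons u x) y) = reduced (rcons u x) && (y != linv x).
Proof. by rewrite -cats1 cat_rcons reduced_cat_cons /= andbT. Qed.

Lemma reduced_catl u v : reduced (u ++ v) -> reduced u.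
Proof.
case/lastP: u => [|u x] //.
by rewrite cat_rcons reduced_cat_cons => /andP[].
Qed.

Lemma reduced_catr u v : reduced (u ++ v) -> reduced v.
Proof. by case: v => [|x v] //; rewrite reduced_cat_cons => /andP[]. Qed.

Lemma reduced_behead x w : reduced (x :: w) -> reduced w.
Proof. exact: (@reduced_catr [:: x]). Qed.

Lemma reduced_glue u v w :
  v != [::] -> reduced (u ++ v) -> reduced (v ++ w) -> reduced (u ++ v ++ w).
Proof.
case: v => // x v _; rewrite !cat_cons !reduced_cat_cons.
by move=> /andP[-> _] ->.
Qed.

Lemma finvK : involutive (@finv d).
Proof.
move=> w; rewrite /finv map_rev revK -map_comp -[RHS]map_id.
by apply: eq_map => x /=; rewrite linvK.
Qed.

Lemma finv_cat u v : finv (u ++ v) = finv v ++ finv u.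
Proof. by rewrite /finv map_cat rev_cat. Qed.

Lemma finv_cons x u : finv (x :: u) = rcons (finv u) (linv x).
Proof. by rewrite /finv /= rev_cons. Qed.

Lemma size_finv u : size (finv u) = size u.
Proof. by rewrite /finv size_rev size_map. Qed.

Lemma finv_eq0 u : (finv u == [::]) = (u == [::]).
Proof. by rewrite -!size_eq0 size_finv. Qed.

Lemma reduced_finv u : reduced u -> reduced (finv u).
Proof.
elim: u => [|x [|y u] IH] //= /andP[xy /IH].
rewrite finv_cons finv_cons => ru.
by rewrite finv_cons reduced_rcons2 ru /= linvK eq_sym.
Qed.

Lemma reduced_push x w : reduced w -> reduced (push x w).
Proof.
case: w => [|y w] //= rw; case: ifPn => [_|ne]; first exact: reduced_behead rw.
by rewrite reduced_cons ne.
Qed.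

Lemma pushK x w : reduced w -> push (linv x) (push x w) = w.
Proof.
case: w => [|y w] /=; first by rewrite linvK eqxx.
case: eqP => [-> |_ _] /=; last by rewrite linvK eqxx.
by case: w => [|z w] //= /andP[/negbTE ->].
Qed.

Lemma pushVK x w : reduced w -> push x (push (linv x) w) = w.
Proof. by move=> rw; rewrite -{1}(linvK x) pushK. Qed.

Lemma reduced_fmul u v : reduced v -> reduced (fmul u v).
Proof. by move=> rv; elim: u => //= x u; apply: reduced_push. Qed.

Lemma fmul_cat u v w : fmul (u ++ v) w = fmul u (fmul v w).
Proof. by rewrite /fmul foldr_cat. Qed.

Lemma fmulA u v w : reduced w -> fmul (fmul u v) w = fmul u (fmul v w).
Proof.
move=> rw; elim: u => //= x u <-; case: (fmul u v) => [|y s] //=.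
by case: eqP => [->|] //; rewrite /= pushVK //; apply: reduced_fmul.
Qed.

Lemma fmul_reduced u v : reduced (u ++ v) -> fmul u v = u ++ v.
Proof.
elim: u => //= x u IH ruv; rewrite IH; last by case: (u ++ v) ruv => // y s /andP[].
by case: (u ++ v) ruv => //= y s /andP[/negbTE ->].
Qed.

Lemma fmul0 u : reduced u -> fmul u [::] = u.
Proof. by move=> ru; rewrite fmul_reduced cats0. Qed.

Lemma fmulVK u v : reduced v -> fmul u (fmul (finv u) v) = v.
Proof.
move=> rv; elim: u v rv => //= x u IH v rv.
rewrite finv_cons -cats1 fmul_cat /= IH ?pushVK //.
exact: reduced_push.
Qed.

Lemma fmulKV u v : reduced v -> fmul (finv u) (fmul u v) = v.
Proof. by move=> rv; rewrite -{2}(finvK u) fmulVK. Qed.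

Lemma fmulV u : reduced u -> fmul u (finv u) = [::].
Proof.
by move=> ru; rewrite -[in X in fmul u X](fmul0 (reduced_finv ru)) fmulVK.
Qed.

Lemma finv_fmul u v :
  reduced u -> reduced v -> finv (fmul u v) = fmul (finv v) (finv u).
Proof.
move=> ru rv; have ruv := reduced_fmul u rv.
have riu := reduced_finv ru; have riv := reduced_finv rv.
rewrite -[RHS](@fmulKV (fmul u v)) ?reduced_fmul // fmulA ?reduced_fmul //.
by rewrite fmulVK // fmulV // fmul0 // reduced_finv.
Qed.

Lemma size_fmul u v : (size (fmul u v) <= size u + size v)%N.
Proof.
elim: u => //= x u IH; apply: (@leq_trans (size (fmul u v)).+1); last by rewrite addSn.
by case: (fmul u v) => //= y s; case: ifP => //= _; rewrite -ltnS ltnW.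
Qed.

Lemma size_fmulr u v : reduced v -> (size v <= size u + size (fmul u v))%N.
Proof.
by move=> rv; rewrite -{1}(fmulKV u rv) (leq_trans (size_fmul _ _)) ?size_finv.
Qed.

Lemma size_fmull u v :
  reduced u -> reduced v -> (size u <= size (fmul u v) + size v)%N.
Proof.
move=> ru rv; rewrite -(size_finv (fmul u v)) finv_fmul // addnC -(size_finv u).
by rewrite -(size_finv v) size_fmulr // reduced_finv.
Qed.

(** [q] is what cancels: in the tree, [h1] is the branching point of the tripod spanned by 1, [h]
    and [fmul h p]. *)
Lemma fmul_split h p : reduced h -> reduced p ->
  exists h1 q p1, [/\ h = h1 ++ finv q, p = q ++ p1 & reduced (h1 ++ p1)].
Proof.
elim/last_ind: h p => [|h x IH] p rh rp; first by exists [::], [::], p.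
case: p rp => [|y p] rp.
  by exists (rcons h x), [::], [::]; rewrite ?cats0.
have [yx|yx] := eqVneq y (linv x); last first.
  exists (rcons h x), [::], (y :: p); rewrite cats0; split=> //.
  by rewrite cat_rcons reduced_cat_cons rh reduced_cons yx.
have rh' : reduced h by move: rh; rewrite -cats1; apply: reduced_catl.
have [h1 [q [p1 [-> -> rc]]]] := IH p rh' (reduced_behead rp).
by exists h1, (y :: q), p1; rewrite finv_cons yx linvK -rcons_cat.
Qed.

Lemma fmul_splitE h1 q p1 :
  reduced (h1 ++ p1) -> fmul (h1 ++ finv q) (q ++ p1) = h1 ++ p1.
Proof.
move=> rc; have rp := reduced_catr rc.
have -> : fmul (h1 ++ finv q) (q ++ p1) = fmul h1 p1.
  rewrite fmul_cat; congr fmul.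
  elim: q => //= x q IH; rewrite finv_cons -cats1 fmul_cat /= linvK eqxx.
  exact: IH.
exact: fmul_reduced.
Qed.

(* Locked, so that rewriting with lemmas on [++] does not unfold it. *)
Definition wpow c n : word d := locked (flatten (nseq n c)).

Lemma wpow0 c : wpow c 0 = [::]. Proof. by rewrite /wpow -lock. Qed.

Lemma wpowS c n : wpow c n.+1 = c ++ wpow c n.
Proof. by rewrite /wpow -!lock. Qed.

Lemma wpow1 c : wpow c 1 = c. Proof. by rewrite wpowS wpow0 cats0. Qed.

Lemma wpowD c m n : wpow c (m + n) = wpow c m ++ wpow c n.
Proof. by rewrite /wpow -!lock nseqD flatten_cat. Qed.

Lemma finv_wpow c n : finv (wpow c n) = wpow (finv c) n.
Proof.
elim: n => [|n IH]; first by rewrite !wpow0.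
by rewrite wpowS finv_cat IH -{2}(wpow1 (finv c)) -wpowD addn1.
Qed.

Lemma size_wpow c n : size (wpow c n) = (n * size c)%N.
Proof.
elim: n => [|n IH]; first by rewrite wpow0.
by rewrite wpowS size_cat IH mulSn.
Qed.

Lemma reduced_wpow u c v n : c != [::] -> reduced (c ++ c) ->
  reduced (u ++ c) -> reduced (c ++ v) -> reduced (u ++ wpow c n.+1 ++ v).
Proof.
move=> c0 rcc ru rv; elim: n u ru => [|n IH] u ru.
  by rewrite wpow1; apply: reduced_glue.
rewrite wpowS -catA; apply: reduced_glue => //.
by rewrite -[c ++ _]cat0s; apply: (IH c).
Qed.

(** Mutually inverse outer letters are stripped one pair at a time; since a reduced word never
    contains x x^-1, the core does not vanish. *)
Lemma cyclic_reduction g : reduced g -> g != [::] ->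
  exists t c, [/\ g = t ++ c ++ finv t, c != [::] & reduced (c ++ c)].
Proof.
have [n] := ubnP (size g); elim: n g => // n IH g ltn rg g0.
case E: (reduced (g ++ g)); first by exists [::], g; rewrite cats0.
case: g rg g0 ltn E => // x g rg _ ltn E.
case/lastP: g rg ltn E => [|g y] rg ltn E.
  by move: E; rewrite /= andbT eq_sym linv_neq.
have yx : y = linv x.
  move: E; rewrite -rcons_cons cat_rcons reduced_cat_cons.
  by move=> /negbT; rewrite rcons_cons rg reduced_cons rg andbT negbK eq_linv => /eqP.
have g0 : g != [::] by apply: contraTneq rg => ->; rewrite yx /= eqxx.
have rg' : reduced g.
  by move: rg; rewrite -cats1 => /reduced_behead/reduced_catl.
have ltg : (size g < n)%N by move: ltn; rewrite /= size_rcons ltnS => /ltnW.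
have [t [c [-> c0 rc]]] := IH g ltg rg' g0.
exists (x :: t), c; split=> //.
by rewrite finv_cons yx -!cats1 -!catA.
Qed.

(** Between successive factors [finv t] cancels against [t], and [reduced (c ++ c)] rules out any
    further cancellation. *)
Lemma fpow_conj t c n : reduced (t ++ c ++ finv t) -> c != [::] ->
  reduced (c ++ c) -> fpow (t ++ c ++ finv t) n.+1 = t ++ wpow c n.+1 ++ finv t.
Proof.
move=> rg c0 rcc; elim: n => [|n IH].
  by rewrite /= fmul0 // wpow1.
have rtc : reduced (t ++ c) by move: rg; rewrite catA => /reduced_catl.
have rct : reduced (c ++ finv t) by apply: reduced_catr rg.
have -> : fpow (t ++ c ++ finv t) n.+2
   = fmul (t ++ c ++ finv t) (fpow (t ++ c ++ finv t) n.+1) by [].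
rewrite IH catA fmul_splitE; first by rewrite [in RHS]wpowS -!catA.
have := reduced_wpow n c0 rcc rcc rct.
by rewrite -[(t ++ c) ++ _]catA; apply: reduced_glue.
Qed.

Lemma reduced_fpow g n : reduced (fpow g n).
Proof. by elim: n => //= n IH; apply: reduced_fmul. Qed.

Lemma fpowD g m n : fpow g (m + n) = fmul (fpow g m) (fpow g n).
Proof. by elim: m => //= m IH; rewrite IH fmulA // reduced_fpow. Qed.

End FreeGroup.

(** * The hull of a subgroup *)

Section Hull.
Variable d : nat.
Implicit Types (x y z : letter d) (u v w p q r g h t c : word d).

Definition hull (H : set (word d)) : set (word d) :=
  [set p | exists r, H (p ++ r)].

Lemma is_subgroup_reduced : is_subgroup [set p : word d | reduced p].
Proof.
split=> //; split=> //; split=> [p q _|p]; [exact: reduced_fmul|exact: reduced_finv].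
Qed.

Section Subgroup.
Variable H : set (word d).
Hypothesis sH : is_subgroup H.

Lemma subg_reduced h : H h -> reduced h. Proof. by case: sH => + _; apply. Qed.

Lemma subg1 : H [::]. Proof. by case: sH => _ []. Qed.

Lemma subgM h g : H h -> H g -> H (fmul h g).
Proof. by case: sH => _ [_ [+ _]]; apply. Qed.

Lemma subgV h : H h -> H (finv h).
Proof. by case: sH => _ [_ [_]]; apply. Qed.

Lemma hull_reduced p : hull H p -> reduced p.
Proof. by case=> r /subg_reduced/reduced_catl. Qed.

Lemma hull_catl p r : hull H (p ++ r) -> hull H p.
Proof. by case=> q; rewrite -catA; exists (r ++ q). Qed.

Lemma hull1 : hull H [::]. Proof. by exists [::]; apply: subg1. Qed.

(* The geodesic from h to h p r lies in the union of those from 1 to h and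
   from 1 to h p r, so the hull is H-invariant. *)
Lemma hullM h p : H h -> hull H p -> hull H (fmul h p).
Proof.
move=> Hh [r Hpr]; have rh := subg_reduced Hh; have rpr := subg_reduced Hpr.
have rp := reduced_catl rpr.
have [h1 [q [p1 [eh ep rc]]]] := fmul_split rh rp.
have -> : fmul h p = h1 ++ p1 by rewrite eh ep fmul_splitE.
have [p10|p10] := eqVneq p1 [::].
  by rewrite p10 cats0; exists (finv q); rewrite -eh.
exists r; suff <- : fmul h (p ++ r) = (h1 ++ p1) ++ r by apply: subgM.
rewrite eh ep -catA fmul_splitE -?catA //; apply: reduced_glue => //.
by move: rpr; rewrite ep -catA => /reduced_catr.
Qed.

Lemma exit_point p : ~ hull H p ->
  exists u x r, [/\ p = u ++ x :: r, hull H u & ~ hull H (rcons u x)].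
Proof.
elim/last_ind: p => [|p x IH] np; first by case: np; apply: hull1.
have [hp|/IH[u [y [r [-> hu hy]]]]] := pselect (hull H p).
  by exists p, x, [::]; rewrite cats1.
by exists u, y, (rcons r x); rewrite rcons_cat.
Qed.

(** Prefixes of generators represent the hull modulo [H]: the elements of [H] all of whose prefixes
    are translates of such words form a subgroup containing the generators. *)
Lemma fin_gen_hull : fin_gen H -> exists E : seq (word d), forall p, hull H p ->
  exists h e, [/\ H h, e \in E, reduced e & p = fmul h e].
Proof.
move=> [S [/allP rS genS]].
(* The empty word is added by hand to cover an empty list of generators. *)
pose E := [::] :: [seq take i s | s <- S, i <- iota 0 (size s).+1].
have inE s p r : s \in S -> s = p ++ r -> p \in E.
  move=> sS es; rewrite inE; apply/orP; right; apply/allpairsPdep.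
  exists s, (size p); split=> //; last by rewrite es take_size_cat.
  by rewrite mem_iota /= add0n ltnS es size_cat leq_addr.
exists E; pose good p := exists h e, [/\ H h, e \in E, reduced e & p = fmul h e].
have goodM h p : H h -> good p -> good (fmul h p).
  move=> Hh [k [e [Hk eE re ->]]]; exists (fmul h k), e.
  by rewrite fmulA //; split=> //; apply: subgM.
suff HM s : H s -> H s /\ forall p r, s = p ++ r -> good p.
  by move=> p [r /HM[_ /(_ _ _ erefl)]].
move/genS => /(_ [set k | H k /\ forall p r, k = p ++ r -> good p]); apply.
- split=> [k [/subg_reduced]|] //; split.
    split; first exact: subg1.
    move=> [|? ?] // _ _; exists [::], [::]; split=> //; exact: subg1.
  split=> [k l [Hk gk] [Hl gl]|k [Hk gk]].
    split; first exact: subgM.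
    move=> p r ep; have [h1 [q [l1 [ek el rc]]]] :=
      fmul_split (subg_reduced Hk) (subg_reduced Hl).
    have {}ep : h1 ++ l1 = p ++ r by rewrite -ep ek el fmul_splitE.
    (* A prefix of the product either is a prefix of [k], or extends beyond [h1] and is then [k]
       times a prefix of [l]. *)
    have [le|lt] := leqP (size p) (size h1).
      apply: (gk p (drop (size p) h1 ++ finv q)); rewrite ek catA; congr (_ ++ _).
      by rewrite -[p in p ++ _](take_size_cat r erefl) -ep takel_cat // cat_take_drop.
    have epp : p = h1 ++ take (size p - size h1) l1.
      by rewrite -[LHS](take_size_cat r erefl) -ep take_cat ltnNge ltnW.
    have rc' : reduced (h1 ++ take (size p - size h1) l1).
      rewrite -epp; apply: (@reduced_catl _ _ r).
      by rewrite -ep.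
    rewrite epp -(fmul_splitE q rc') -ek; apply: goodM => //.
    apply: (gl _ (drop (size p - size h1) l1)).
    by rewrite -catA cat_take_drop.
  split; first exact: subgV.
  move=> p r ep.
  (* Here [finv r] is a prefix of [k], hence already good. *)
  have -> : p = fmul (finv k) (finv r).
    have := @fmul_splitE _ p (finv r) [::]; rewrite ep finvK !cats0 => -> //.
    by apply: (@reduced_catl _ _ r); rewrite -ep reduced_finv // subg_reduced.
  apply: goodM; first exact: subgV.
  by apply: (gk _ (finv p)); rewrite -finv_cat -ep finvK.
- move=> s' sS; split; first by apply/genS => M _; apply.
  move=> p r es; exists [::], p; split=> //; [exact: subg1|exact: inE sS es|].
  by apply: (@reduced_catl _ _ r); rewrite -es rS.
Qed.

(** Pigeonhole: if the whole ray lay in the hull, two of its points t c^i and t c^j with i < j would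
    share a representative modulo [H], which would put t c^(j-i) t^-1, a positive power of the
    conjugated word, into [H]. *)
Lemma wpow_escape t c : fin_gen H -> reduced (t ++ c ++ finv t) ->
  c != [::] -> reduced (c ++ c) ->
  (forall m, ~ H (fpow (t ++ c ++ finv t) m.+1)) ->
  exists N, ~ hull H (t ++ wpow c N).
Proof.
move=> /fin_gen_hull[E hE] rg c0 rcc nH; apply: contrapT => /forallNP inP.
have {}inP n : exists he : word d * word d,
    [/\ H he.1, he.2 \in E, reduced he.2 & t ++ wpow c n = fmul he.1 he.2].
  by have [h [e]] := hE _ (contrapT (inP n)); exists (h, e).
have [f fP] := choice inP.
pose l := [seq (f n).2 | n <- iota 0 (size E).+1].
have : ~~ uniq l.
  apply/negP => ul; have : {subset l <= E} by move=> e /mapP[n _ ->]; case: (fP n).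
  by move=> /(uniq_leq_size ul); rewrite size_map size_iota ltnn.
case/(uniqPn [::]) => i [j [ij]]; rewrite size_map size_iota => lj.
rewrite !(nth_map 0%N) ?size_iota ?(ltn_trans ij) //.
rewrite !nth_iota ?(ltn_trans ij) // !add0n.
move=> eij; apply: (nH (j - i).-1); rewrite fpow_conj // prednK ?subn_gt0 //.
have [Hi _ _ ei] := fP i; have [Hj _ re ej] := fP j.
have rhi := subg_reduced Hi.
have -> : t ++ wpow c (j - i) ++ finv t = fmul (t ++ wpow c j) (finv (t ++ wpow c i)).
  have rr : reduced ((t ++ wpow c (j - i)) ++ finv t).
    have -> : (j - i)%N = (j - i).-1.+1 by rewrite prednK ?subn_gt0.
    by rewrite -catA -fpow_conj //; exact: reduced_fpow.
  have := fmul_splitE (finv (wpow c i)) rr.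
  by rewrite finvK -finv_cat -!catA -wpowD (subnK (ltnW ij)) => ->.
rewrite ei ej eij finv_fmul // fmulA ?reduced_fmul ?reduced_finv //.
by rewrite fmulVK ?reduced_finv //; apply: subgM => //; apply: subgV.
Qed.

(** The first letter of [w] decides: the hull is closed under prefixes, so no longer prefix of
    [u ++ w] comes back to it. *)
Definition leaves u w :=
  hull H u /\ exists x w1, w = x :: w1 /\ ~ hull H (rcons u x).

(** The exit points [u] and [v] of the two rays are fixed before [k] is given, which makes [L]
    uniform; only the middle part [w] grows. *)
Lemma power_escape g : fin_gen H -> reduced g -> (forall m, ~ H (fpow g m.+1)) ->
  exists L, forall k, exists n u v w,
    [/\ [/\ (k <= n)%N, finv (fpow g n) = u ++ w ++ finv v & (k <= size w)%N],
        (size u <= L)%N, (size v <= L)%N, leaves u w & leaves v (finv w)].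
Proof.
move=> fH rg nH; have g0 : g != [::].
  by apply/eqP => g0; apply: (nH 0%N); rewrite g0; exact: subg1.
have [t [c [eg c0 rcc]]] := cyclic_reduction rg g0.
have rtc : reduced (t ++ c ++ finv t) by rewrite -eg.
have nH1 m : ~ H (fpow (t ++ c ++ finv t) m.+1) by rewrite -eg.
have [N hN] := wpow_escape fH rtc c0 rcc nH1.
have eVg : t ++ finv c ++ finv t = finv g by rewrite eg !finv_cat finvK catA.
have rtc' : reduced (t ++ finv c ++ finv t) by rewrite eVg reduced_finv.
have c0' : finv c != [::] by rewrite finv_eq0.
have rcc' : reduced (finv c ++ finv c) by rewrite -finv_cat reduced_finv.
have fpowV n : fpow (finv g) n.+1 = finv (fpow g n.+1).
  by rewrite -eVg eg !fpow_conj // !finv_cat finvK finv_wpow catA.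
have nH2 m : ~ H (fpow (t ++ finv c ++ finv t) m.+1).
  by rewrite eVg fpowV => /subgV; rewrite finvK; apply: nH.
have [N' hN'] := wpow_escape fH rtc' c0' rcc' nH2.
have [u [x [r [eu hu nu]]]] := exit_point hN'.
have [v [y [s [ev hv nv]]]] := exit_point hN.
exists (maxn (size u) (size v)) => k.
(* The outer N' and N periods contain the two exits; the k + 1 middle periods make [w] long. *)
exists (N' + k.+1 + N)%N, u, v, ((x :: r) ++ wpow (finv c) k.+1 ++ finv (y :: s)).
split; rewrite ?leq_maxl ?leq_maxr //.
- split.
  + by rewrite addnAC -[k in (k <= _)%N]add0n leq_add.
  + have -> : (N' + k.+1 + N = (N' + k + N).+1)%N by rewrite addnS addSn.
    rewrite -fpowV -eVg fpow_conj // -addSn -addnS !wpowD.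
    have -> : wpow (finv c) N = finv (wpow c N) by rewrite finv_wpow.
    by rewrite !catA eu -!catA -finv_cat ev finv_cat !catA.
  + rewrite !size_cat size_wpow size_finv.
    apply: leq_trans (leq_addl _ _); apply: leq_trans (leq_addr _ _).
    by rewrite (leq_trans (leqnSn k)) // leq_pmulr // lt0n size_eq0.
- by split=> //; exists x, (r ++ wpow (finv c) k.+1 ++ finv (y :: s)).
- split=> //; exists y, (s ++ wpow c k.+1 ++ finv (x :: r)).
  by rewrite !finv_cat finvK finv_wpow finvK -catA.
Qed.

(** The identity is left out, since it would let the two neighbouring copies of [w] and [finv w]
    meet and cancel. *)
Definition conjugates u : set (word d) :=
  [set p | exists h, [/\ H h, h != [::] & p = fmul (finv u) (fmul h u)]].

Section Leaves.
Variables u w : word d.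
Hypotheses (luw : leaves u w) (ruw : reduced (u ++ w)).

(** If h u ended with the inverse of the first letter x of [w], then h u x would be a prefix of h u,
    hence in the hull, and translating by h^-1 would put u x there. *)
Lemma leaves_fmul h : H h -> reduced (fmul h u ++ w).
Proof.
move=> Hh; case: luw => hu [x [w1 [ew nx]]].
have rux : reduced (rcons u x).
  by move: ruw; rewrite ew reduced_cat_cons => /andP[].
rewrite ew reduced_cat_cons -ew (reduced_catr ruw) andbT.
have hhu := hullM Hh hu.
case/lastP E : (fmul h u) => [|p y] //; rewrite reduced_rcons2.
rewrite -E (hull_reduced hhu) /=; apply/eqP => xy; apply: nx.
have -> : rcons u x = fmul (finv h) p; last first.
  apply: hullM; first exact: subgV.
  by apply: (@hull_catl _ [:: y]); rewrite cats1 -E.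
have -> : p = fmul (fmul h u) [:: x].
  have rp : reduced p.
    by apply: (@reduced_catl _ _ [:: y]); rewrite cats1 -E; apply: hull_reduced.
  have := @fmul_splitE _ p [:: x] [::].
  rewrite cats0 /finv /= /rev /= cats1 E xy linvK => -> //.
rewrite fmulA // fmulKV ?reduced_fmul // fmul_reduced ?cats1 //.
Qed.

Lemma leaves_fmulV h : H h -> reduced (finv w ++ fmul (finv u) h).
Proof.
move=> Hh; have ru := reduced_catl ruw; have rh := subg_reduced Hh.
have := reduced_finv (leaves_fmul (subgV Hh)).
by rewrite finv_cat finv_fmul ?reduced_finv // finvK.
Qed.

Lemma conjugates_neq0 p : conjugates u p -> p != [::].
Proof.
have ru := reduced_catl ruw; case=> h [Hh h0 ->]; have rh := subg_reduced Hh.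
apply: contra_neq h0 => e0.
rewrite -(fmul0 rh) -{1}(fmulV ru) -fmulA ?reduced_finv //.
by rewrite -(@fmulVK _ u (fmul h u)) ?reduced_fmul // e0 fmul0 // fmulV.
Qed.

Lemma conjugatesV p : conjugates u p -> conjugates u (finv p).
Proof.
have ru := reduced_catl ruw; case=> h [Hh h0 ->]; have rh := subg_reduced Hh.
exists (finv h); split; [exact: subgV|by rewrite finv_eq0|].
rewrite finv_fmul ?reduced_fmul ?reduced_finv // finvK finv_fmul //.
by rewrite fmulA.
Qed.

(** If [p] began with the first letter x of [w], then u x would be a prefix of h u, which lies in
    the hull. *)
Lemma reduced_finv_conjugates p : conjugates u p -> reduced (finv w ++ p).
Proof.
have ru := reduced_catl ruw.
case: luw => hu [x [w1 [ew nx]]] [h [Hh _ ep]].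
have rp : reduced p by rewrite ep !reduced_fmul.
rewrite ew finv_cons cat_rcons reduced_cat_cons -finv_cons -ew.
rewrite reduced_finv ?(reduced_catr ruw) // andTb.
case: p rp ep => [|y p] // rp ep; rewrite reduced_cons linvK rp andbT.
apply/eqP => yx; rewrite yx in rp ep; apply: nx; apply: (@hull_catl _ p).
suff -> : rcons u x ++ p = fmul h u by apply: hullM.
rewrite -(@fmulVK _ u (fmul h u)) ?reduced_fmul // -ep cat_rcons.
rewrite fmul_reduced // reduced_cat_cons rp andbT.
by move: ruw; rewrite ew reduced_cat_cons => /andP[].
Qed.

Lemma reduced_conjugates_cat p : conjugates u p -> reduced (p ++ w).
Proof.
move=> /conjugatesV/reduced_finv_conjugates/reduced_finv.
by rewrite finv_cat !finvK.
Qed.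

End Leaves.
End Subgroup.
End Hull.

(** * Normal forms in the subgroup generated by H and a conjugate *)

Section Amalgam.
Variable d : nat.
Implicit Types (x y z : letter d) (u v w p q r g h t c : word d).

(** Taking an intersection of subgroups gives an induction principle: a property of all elements
    follows by exhibiting a suitable [M]. *)
Definition amalg (H : set (word d)) g : set (word d) :=
  [set p | forall M, is_subgroup M ->
     (forall h, H h -> M h /\ M (fmul g (fmul h (finv g)))) -> M p].

Section AmalgamTheory.
Variables (H : set (word d)) (g : word d).
Hypotheses (sH : is_subgroup H) (rg : reduced g).

Lemma reduced_conj h : reduced (fmul g (fmul h (finv g))).
Proof. by rewrite !reduced_fmul // reduced_finv. Qed.

Lemma conjM h k : reduced h -> reduced k ->
  fmul (fmul g (fmul h (finv g))) (fmul g (fmul k (finv g)))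
  = fmul g (fmul (fmul h k) (finv g)).
Proof.
move=> rh rk; have rVg := reduced_finv rg.
by rewrite !fmulA ?reduced_fmul // fmulKV ?reduced_fmul.
Qed.

Lemma conjV h : reduced h ->
  finv (fmul g (fmul h (finv g))) = fmul g (fmul (finv h) (finv g)).
Proof.
move=> rh; have rVg := reduced_finv rg; have rVh := reduced_finv rh.
by rewrite !finv_fmul ?reduced_fmul // finvK fmulA.
Qed.

Lemma amalg_subgroup : is_subgroup (amalg H g).
Proof.
split=> [p ap|].
  apply: (ap _ (is_subgroup_reduced d)) => h /(subg_reduced sH) rh.
  by split=> //; apply: reduced_conj.
split=> [M sM _|]; first exact: subg1.
split=> [p q pM qM M sM HM|p pM M sM HM].
  by apply: subgM => //; [apply: pM|apply: qM].
by apply: subgV => //; apply: pM.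
Qed.

Lemma sub_amalg : H `<=` amalg H g.
Proof. by move=> h Hh M _ /(_ h Hh)[]. Qed.

Lemma conj_amalg h : H h -> amalg H g (fmul g (fmul h (finv g))).
Proof. by move=> Hh M _ /(_ h Hh)[]. Qed.

Lemma subgroup_conj M : is_subgroup M ->
  is_subgroup [set p | reduced p /\ M (fmul g (fmul p (finv g)))].
Proof.
move=> sM; split=> [p []|] //; split.
  by split=> //=; rewrite fmulV //; apply: subg1.
split=> [p q [rp Mp] [rq Mq]|p [rp Mp]].
  by split; [exact: reduced_fmul|rewrite -conjM //; apply: subgM].
by split; [exact: reduced_finv|rewrite -conjV //; apply: subgV].
Qed.

Lemma amalg_fin_gen : fin_gen H -> fin_gen (amalg H g).
Proof.
move=> [S [rS genS]]; exists (S ++ [seq fmul g (fmul s (finv g)) | s <- S]); split.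
  by rewrite all_cat rS /=; apply/allP => _ /mapP[s _ ->]; apply: reduced_conj.
have SH s : s \in S -> H s by move=> sS; apply/genS => M _; apply.
move=> p; split=> [ap M sM MS|ap M sM HM].
  apply: ap => // h /genS hS; split.
    by apply: hS => // s sS; apply: MS; rewrite mem_cat sS.
  (* The words that [g] conjugates into [M] form a subgroup, so the generators of [H] are enough. *)
  have [] // := hS _ (subgroup_conj sM).
  move=> s sS; split; first exact: (allP rS).
  by apply: MS; rewrite mem_cat (map_f (fun s => fmul g (fmul s (finv g)))) ?orbT.
apply: ap => // s; rewrite mem_cat => /orP[/SH/HM[]//|/mapP[t /SH/HM[_ ? ->]]//].
Qed.

End AmalgamTheory.

(** Conjugation by g^-1 turns <H, g H g^-1> into <g^-1 H g, H>, so estimates for [amalg] also serve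
    for the conjugated group. *)
Lemma amalg_conjV (H : set (word d)) g p : is_subgroup H -> reduced g -> reduced p ->
  amalg H g (fmul g (fmul p (finv g))) -> amalg H (finv g) p.
Proof.
move=> sH rg rp ap M sM HM; have rVg := reduced_finv rg.
have cK q : reduced q ->
    fmul (finv g) (fmul (fmul g (fmul q (finv g))) (finv (finv g))) = q.
  move=> rq; rewrite finvK !fmulA ?reduced_fmul // fmulKV ?reduced_fmul //.
  by rewrite -{2}(finvK g) fmulV // fmul0.
have [] := ap _ (subgroup_conj rVg sM); last by rewrite cK.
move=> h Hh; have rh := subg_reduced sH Hh; have [Mh Mgh] := HM h Hh.
by split; split=> //; [exact: reduced_conj|rewrite cK].
Qed.

(** Plain concatenation instead of the group product, so that weights multiply. *)
Definition catset (X Y : set (word d)) : set (word d) :=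
  [set p ++ q | p in X & q in Y].

Section NormalForm.
Variables (H : set (word d)) (u v w : word d).
Hypotheses (sH : is_subgroup H) (luw : leaves H u w) (lvw : leaves H v (finv w)).
Hypothesis rG : reduced (u ++ w ++ finv v).
Let G := u ++ w ++ finv v.

Let ruw : reduced (u ++ w). Proof. by move: rG; rewrite catA => /reduced_catl. Qed.
Let rvw : reduced (v ++ finv w).
Proof. by have := reduced_finv (reduced_catr rG); rewrite finv_cat finvK. Qed.
Let ru : reduced u. Proof. exact: reduced_catl ruw. Qed.
Let rv : reduced v. Proof. exact: reduced_catl rvw. Qed.
Let rw : reduced w. Proof. exact: reduced_catr ruw. Qed.
Let rVw : reduced (finv w). Proof. exact: reduced_finv. Qed.
Let rVu : reduced (finv u). Proof. exact: reduced_finv. Qed.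
Let rVv : reduced (finv v). Proof. exact: reduced_finv. Qed.
Let w0 : w != [::]. Proof. by case: luw => _ [x [w1 [-> _]]]. Qed.

(** What may follow a return to the first copy along [finv w]: a final arc to a point of [H], or a
    nontrivial passage through that copy back to [u] and a further loop. *)
Definition tails (Y : set (word d)) : set (word d) :=
  [set fmul (finv u) h | h in H] `|` catset (conjugates H u) Y.

(* Words read, after u, along reduced loops in the graph made of two copies of
   the core of H joined by a segment labelled w; m bounds the number of visits
   to the second copy. *)
Fixpoint loops m : set (word d) :=
  if m is m'.+1 then
    catset (catset [set w] (catset (conjugates H v) [set finv w])) (tails (loops m'))
  else set0.

Lemma tails_mono (Y Z : set (word d)) : Y `<=` Z -> tails Y `<=` tails Z.
Proof.
move=> YZ p [Cp|[q cq [r Yr <-]]]; [by left|right].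
by exists q => //; exists r => //; apply: YZ.
Qed.

Lemma loops_mono m n : (m <= n)%N -> loops m `<=` loops n.
Proof.
elim: m n => [|m IH] [|n] // mn; [by move=> ? []|by move=> ? []|].
move=> _ [p pP [q qP <-]]; exists p => //; exists q => //.
by apply: tails_mono qP; apply: IH.
Qed.

Lemma loop_cat (y r : word d) : conjugates H v y -> reduced (finv w ++ r) ->
  reduced (w ++ y ++ finv w ++ r).
Proof.
move=> cy rr; apply: reduced_glue.
- exact: (conjugates_neq0 sH rvw).
- by have := reduced_finv_conjugates sH lvw rvw cy; rewrite finvK.
- apply: reduced_glue => //; first by rewrite finv_eq0.
  exact: (reduced_conjugates_cat sH lvw rvw cy).
Qed.

(** The claim on [loops m] is a hypothesis because the two facts are proved by a joint induction,
    closed in [loops_reduced]. *)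
Lemma tails_reduced m r :
  (forall p, loops m p -> exists2 q, p = w ++ q & reduced p) ->
  tails (loops m) r -> reduced (finv w ++ r).
Proof.
move=> IH [[h Hh <-]|[y cy [p Lp <-]]]; first exact: (leaves_fmulV sH luw ruw Hh).
apply: reduced_glue.
- exact: (conjugates_neq0 sH ruw).
- exact: (reduced_finv_conjugates sH luw ruw cy).
- have [q -> rp] := IH _ Lp; apply: reduced_glue => //.
  exact: (reduced_conjugates_cat sH luw ruw cy).
Qed.

Lemma loops_reduced m p : loops m p -> exists2 q, p = w ++ q & reduced p.
Proof.
elim: m p => //= m IH _ [_ [_ -> [_ [y cy [_ -> <-]] <-]] [r Tr <-]].
rewrite -!catA; exists (y ++ finv w ++ r) => //.
exact: (loop_cat cy (tails_reduced IH Tr)).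
Qed.

Lemma tailsP m r : tails (loops m) r -> reduced (finv w ++ r).
Proof. exact: tails_reduced (@loops_reduced m). Qed.

(** With [u] in front, the displayed word is G h G^-1 applied to u r: one passage through the second
    copy is prepended. *)
Lemma loopE m h r : H h -> h != [::] -> tails (loops m) r ->
  loops m.+1 (fmul w (fmul (finv v) (fmul h (fmul v (fmul (finv w) r))))).
Proof.
move=> Hh h0 Tr; have rr := tailsP Tr; have r_r := reduced_catr rr.
have cy : conjugates H v (fmul (finv v) (fmul h v)) by exists h.
have := loop_cat cy rr; set y := fmul (finv v) (fmul h v) => ry.
have -> : fmul w (fmul (finv v) (fmul h (fmul v (fmul (finv w) r))))
   = (w ++ y ++ finv w) ++ r.
  rewrite -!catA -[RHS]fmul_reduced //; congr fmul.
  rewrite -[RHS]fmul_reduced ?(reduced_catr ry) //.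
  by rewrite /y !fmulA ?reduced_fmul // (fmul_reduced rr).
exists (w ++ y ++ finv w); last by exists r.
by exists w => //; exists (y ++ finv w) => //; exists y => //; exists (finv w).
Qed.

Lemma loops_inv m p : loops m p -> exists n h r,
  [/\ H h, h != [::], tails (loops n) r
    & p = fmul w (fmul (finv v) (fmul h (fmul v (fmul (finv w) r))))].
Proof.
case: m => //= m [_ [_ -> [_ [y [h [Hh h0 ey]] [_ -> <-]] <-]] [r Tr <-]].
have rr := tailsP Tr; have r_r := reduced_catr rr.
have cy : conjugates H v y by exists h.
have ry := loop_cat cy rr.
exists m, h, r; split=> //.
rewrite -!catA -[LHS]fmul_reduced //; congr fmul.
rewrite -[LHS]fmul_reduced ?(reduced_catr ry) //.
by rewrite ey !fmulA ?reduced_fmul // (fmul_reduced rr).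
Qed.

Definition normal p :=
  H p \/ exists h m q, [/\ H h, loops m q & p = fmul h (fmul u q)].

Lemma normal_tails m r : tails (loops m) r -> normal (fmul u r).
Proof.
move=> [[h Hh <-]|[y [h [Hh h0 ey]] [q Lq <-]]].
  by left; rewrite fmulVK //; apply: subg_reduced Hh.
have [q' eq rq] := loops_reduced Lq.
right; exists h, m, q; split=> //.
have cy : conjugates H u y by exists h.
rewrite -[y ++ q]fmul_reduced.
  by rewrite ey !fmulA ?reduced_fmul // fmulVK ?reduced_fmul.
rewrite eq; apply: reduced_glue => //; last by rewrite -eq.
exact: (reduced_conjugates_cat sH luw ruw cy).
Qed.

(** The alternative is whether the path, once at [u], continues in the first copy or crosses [w] at
    once; multiplication by G h G^-1 behaves differently in the two cases. *)
Lemma normalP p : normal p ->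
  (exists m r, tails (loops m) r /\ p = fmul u r) \/
  (exists m q, loops m q /\ p = fmul u q).
Proof.
move=> [Hp|[h [m [q [Hh Lq ->]]]]].
  left; exists 0%N, (fmul (finv u) p); rewrite fmulVK ?(subg_reduced sH) //.
  by split=> //; left; exists p.
have [h0|h0] := eqVneq h [::]; first by right; exists m, q; rewrite h0.
have [q' eq rq] := loops_reduced Lq.
have cy : conjugates H u (fmul (finv u) (fmul h u)) by exists h.
left; exists m, (fmul (finv u) (fmul h u) ++ q); split.
  by right; exists (fmul (finv u) (fmul h u)) => //; exists q.
rewrite -[X in _ = fmul u X]fmul_reduced.
  by rewrite !fmulA ?reduced_fmul // fmulVK ?reduced_fmul.
rewrite eq; apply: reduced_glue => //; last by rewrite -eq.
exact: (reduced_conjugates_cat sH luw ruw cy).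
Qed.

Lemma normal_reduced p : normal p -> reduced p.
Proof.
move=> [/(subg_reduced sH)//|[h [m [q [Hh /loops_reduced[_ _ rq] ->]]]]].
by rewrite !reduced_fmul.
Qed.

Lemma normalM h p : H h -> normal p -> normal (fmul h p).
Proof.
move=> Hh [Hp|[k [m [q [Hk Lq ->]]]]]; first by left; apply: subgM.
right; exists (fmul h k), m, q; have [_ _ rq] := loops_reduced Lq.
by rewrite fmulA ?reduced_fmul //; split=> //; apply: subgM.
Qed.

Lemma normal_loops m q : loops m q -> normal (fmul u q).
Proof. by right; exists [::], m, q; split=> //; apply: subg1. Qed.

Lemma normal_conj h p : H h -> normal p ->
  normal (fmul G (fmul h (fmul (finv G) p))).
Proof.
move=> Hh np; have rp := normal_reduced np.
have [h0|h0] := eqVneq h [::]; first by rewrite h0 /= fmulVK.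
rewrite /G !finv_cat finvK !fmul_cat.
(* In the first case a new passage is prepended. In the second, [h] merges with the element [k] of
   the first passage, which disappears if h k = 1. *)
have [[m [r [Tr ->]]]|[m [q [Lq ->]]]] := normalP np.
  have r_r := reduced_catr (tailsP Tr).
  by rewrite fmulKV //; apply: (@normal_loops m.+1); apply: loopE.
have [n [k [r [Hk k0 Tr ->]]]] := loops_inv Lq.
have r_r := reduced_catr (tailsP Tr).
rewrite fmulKV ?fmulKV ?fmulVK ?reduced_fmul //.
rewrite -[fmul h (fmul k _)]fmulA ?reduced_fmul //.
have [e0|e0] := eqVneq (fmul h k) [::].
  by rewrite e0 /= fmulKV ?reduced_fmul // fmulVK //; apply: normal_tails Tr.
by apply: (@normal_loops n.+1); apply: loopE => //; apply: subgM.
Qed.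

(** The reduced words that, with their inverses, preserve [normal] under left multiplication form a
    subgroup containing both factors; each of them is then applied to 1. *)
Lemma amalg_normal p : amalg H G p -> normal p.
Proof.
move=> ap; pose M := [set p | reduced p /\
  forall q, normal q -> normal (fmul p q) /\ normal (fmul (finv p) q)].
have n1 : normal [::] by left; apply: subg1.
suff : M p by move=> [rp /(_ _ n1)[]]; rewrite fmul0.
apply: ap => [|h Hh].
- split=> [q []|] //; split; first by split.
  split=> [q r [rq nq] [rr nr]|q [rq nq]]; split.
  + exact: reduced_fmul.
  + move=> s ns; rewrite finv_fmul // !fmulA ?(normal_reduced ns) //.
    by split; [apply: (nq _ (nr _ ns).1).1|apply: (nr _ (nq _ ns).2).2].
  + exact: reduced_finv.
  + by move=> s ns; rewrite finvK; split; apply nq.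
- have Hvh := subgV sH Hh; have rh := subg_reduced sH Hh.
  have rVh := reduced_finv rh; have rVG := reduced_finv rG.
  split; split=> //.
  + by move=> q nq; split; apply: normalM.
  + exact: reduced_conj.
  + move=> q nq; have rq := normal_reduced nq.
    rewrite conjV // !fmulA ?reduced_fmul //.
    by split; apply: normal_conj.
Qed.

Lemma amalg_loops p : amalg H G p -> ~ H p ->
  exists m, catset [set fmul h u | h in H] (loops m) p.
Proof.
move=> /amalg_normal[|[h [m [q [Hh Lq ->]]]]] // _; exists m.
have [q' eq rq] := loops_reduced Lq.
exists (fmul h u); first by exists h.
exists q => //; rewrite -fmulA // [RHS]fmul_reduced //.
rewrite eq; apply: reduced_glue => //; last by rewrite -eq.
exact: (leaves_fmul sH luw ruw Hh).
Qed.

End NormalForm.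
End Amalgam.

(** * Exponential weights *)

Lemma ler_sum_subseq (R : numDomainType) (T : eqType) (F : T -> R) (l l' : seq T) :
  (forall x, 0 <= F x) -> uniq l -> {subset l <= l'} ->
  \sum_(x <- l) F x <= \sum_(x <- l') F x.
Proof.
move=> F0; elim: l l' => [|a l IH] l' /= => [_ _|/andP[al ul] sub].
  by rewrite big_nil; apply: sumr_ge0.
have al' : a \in l' by apply: sub; rewrite mem_head.
rewrite (perm_big _ (perm_to_rem al')) !big_cons lerD2l; apply: IH => // x xl.
have := sub x; rewrite inE xl orbT (perm_mem (perm_to_rem al')) inE => /(_ isT).
by case/orP => // /eqP xa; rewrite xa (negPf al) in xl.
Qed.

Section Weight.
Variables (R : realType) (d : nat) (s : R).
Hypothesis s0 : 0 < s.
Implicit Types (p q u v w : word d) (A B : set (word d)).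

Definition wt p : R := expR (- s * (wlen p)%:R).

(** Convergence of the series with sum at most [c], phrased by finite partial sums so as to compute
    in [R]. *)
Definition wbound A (c : R) := forall l : seq (word d), uniq l ->
  (forall p, p \in l -> A p) -> \sum_(p <- l) wt p <= c.

Lemma wt_ge0 p : 0 <= wt p. Proof. exact: expR_ge0. Qed.

Lemma wt_cat p q : wt (p ++ q) = wt p * wt q.
Proof. by rewrite /wt /wlen size_cat natrD mulrDr expRD. Qed.

Lemma wt_finv p : wt (finv p) = wt p.
Proof. by rewrite /wt /wlen size_finv. Qed.

Lemma wt_small (eta : R) : 0 < eta ->
  exists k, forall p, (k <= size p)%N -> wt p <= eta.
Proof.
move=> eta0; pose x := (s * eta)^-1.
have x0 : 0 <= x by rewrite invr_ge0 mulr_ge0 // ltW.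
exists (Num.truncn x).+1 => p lep; rewrite /wt mulNr expRN -[leRHS]invrK.
rewrite lef_pV2 ?posrE ?expR_gt0 ?invr_gt0 //.
apply: le_trans (expR_ge1Dx _).
apply: (@le_trans _ _ (s * (wlen p)%:R)); last by rewrite lerDr.
have -> : eta^-1 = s * x by rewrite /x invfM mulrA divff ?mul1r // gt_eqF.
rewrite ler_pM2l //.
apply: (@le_trans _ _ (Num.truncn x).+1%:R); last by rewrite ler_nat.
by rewrite ltW // truncnS_gt.
Qed.

Lemma wbound_ge0 A c : wbound A c -> 0 <= c.
Proof. by move=> /(_ [::] isT); rewrite big_nil; apply. Qed.

Lemma wbound_sub A B c : A `<=` B -> wbound B c -> wbound A c.
Proof. by move=> AB wB l ul lA; apply: wB => // p /lA/AB. Qed.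

Lemma wbound_le A c c' : c <= c' -> wbound A c -> wbound A c'.
Proof. by move=> cc wA l ul lA; apply: le_trans cc; apply: wA. Qed.

Lemma wbound_mem A c p : wbound A c -> A p -> wt p <= c.
Proof.
move=> wA Ap; have := wA [:: p] isT; rewrite big_seq1; apply.
by move=> q; rewrite inE => /eqP ->.
Qed.

Lemma wbound0 c : 0 <= c -> wbound set0 c.
Proof. by move=> c0 [|p l] ul lA; [rewrite big_nil|have := lA p (mem_head _ _)]. Qed.

Lemma wbound1 p : wbound [set p] (wt p).
Proof.
move=> l ul lA; rewrite -(big_seq1 GRing.add p wt); apply: ler_sum_subseq => //.
  exact: wt_ge0.
by move=> q /lA ->; rewrite mem_head.
Qed.

Lemma wboundU A B c c' : wbound A c -> wbound B c' -> wbound (A `|` B) (c + c').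
Proof.
move=> wA wB l ul lAB; rewrite (bigID (fun p => `[< A p >])) /=.
rewrite -big_filter -[X in _ + X]big_filter.
apply: lerD; [apply: wA|apply: wB]; rewrite ?filter_uniq // => p.
  by rewrite mem_filter => /andP[/asboolP].
by rewrite mem_filter => /andP[/asboolP nA /lAB[]].
Qed.

(** One preimage is chosen for each value; it is at most [L] letters longer, whence the factor. *)
Lemma wbound_image A c (f : word d -> word d) (L : nat) : wbound A c ->
  (forall p, A p -> (size p <= size (f p) + L)%N) ->
  wbound [set f p | p in A] (expR (s * L%:R) * c).
Proof.
move=> wA fA l ul lA.
have /choice[g gP] : forall q, exists p, q \in l -> A p /\ f p = q.
  by move=> q; have [/lA[p Ap fp]|] := boolP (q \in l); [exists p|exists [::]].
have ug : uniq [seq g q | q <- l].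
  by rewrite map_inj_in_uniq // => q r /gP[_ {2}<-] /gP[_ {2}<-] ->.
have := wA _ ug; rewrite big_map => /(_ _) wl.
apply: le_trans (ler_wpM2l (expR_ge0 _) (wl _)); last first.
  by move=> _ /mapP[q /gP[Ap _] ->].
rewrite mulr_sumr [leLHS]big_seq [leRHS]big_seq; apply: ler_sum => q /gP[Ap fp].
rewrite /wt -expRD ler_expR mulNr mulNr -mulrBr -mulrN ler_pM2l // /wlen.
by rewrite -[in leLHS]fp lerBrDr addrC lerBlDr -natrD ler_nat addnC fA.
Qed.

(** One factorization is chosen for each word; the chosen pairs give some of the terms in the
    expanded product of two sums. *)
Lemma wbound_cat A B c c' : wbound A c -> wbound B c' -> wbound (catset A B) (c * c').
Proof.
move=> wA wB l ul lAB.
have /choice[f fP] : forall q, exists pr : word d * word d,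
    q \in l -> [/\ A pr.1, B pr.2 & pr.1 ++ pr.2 = q].
  move=> q; have [/lAB[p Ap [r Br e]]|] := boolP (q \in l); last by exists ([::], [::]).
  by exists (p, r).
have uf : uniq [seq f q | q <- l].
  by rewrite map_inj_in_uniq // => q r /fP[_ _ {2}<-] /fP[_ _ {2}<-] ->.
pose lA := undup [seq (f q).1 | q <- l]; pose lB := undup [seq (f q).2 | q <- l].
have -> : \sum_(q <- l) wt q = \sum_(pr <- [seq f q | q <- l]) wt pr.1 * wt pr.2.
  by rewrite big_map !big_seq; apply: eq_bigr => q /fP[_ _ {1}<-]; rewrite wt_cat.
apply: (@le_trans _ _ (\sum_(pr <- [seq (p, r) | p <- lA, r <- lB]) wt pr.1 * wt pr.2)).
  apply: ler_sum_subseq => // [[p r]|]; first by rewrite mulr_ge0 ?wt_ge0.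
  move=> _ /mapP[q ql ->]; apply/allpairsP; exists (f q).
  by split; [| |case: (f q)]; rewrite // mem_undup; apply/mapP; exists q.
rewrite big_allpairs /=.
have -> : \sum_(p <- lA) \sum_(r <- lB) wt p * wt r =
    (\sum_(p <- lA) wt p) * \sum_(r <- lB) wt r.
  by rewrite mulr_suml; apply: eq_bigr => p _; rewrite mulr_sumr.
have sum0 (r : seq (word d)) : 0 <= \sum_(p <- r) wt p.
  by apply: sumr_ge0 => p _; apply: wt_ge0.
apply: ler_pM => //.
  apply: wA; rewrite ?undup_uniq // => p.
  by rewrite mem_undup => /mapP[q /fP[? _ _] ->].
apply: wB; rewrite ?undup_uniq // => p.
by rewrite mem_undup => /mapP[q /fP[_ ? _] ->].
Qed.

Lemma wbound_bigcup (F : nat -> set (word d)) c :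
  (forall m n, (m <= n)%N -> F m `<=` F n) -> (forall m, wbound (F m) c) ->
  wbound [set p | exists m, F m p] c.
Proof.
move=> mF wF l ul lF.
suff [m Fm] : exists m, forall p, p \in l -> F m p by apply: (wF m).
elim: l lF {ul} => [|p l IH] lF; first by exists 0%N.
have [q ql|m Fm] := IH; first by apply: lF; rewrite inE ql orbT.
have [n Fn] := lF p (mem_head _ _); exists (maxn m n) => q.
rewrite inE => /orP[/eqP->|/Fm].
  by apply: mF Fn; rewrite leq_maxr.
by apply: mF; rewrite leq_maxl.
Qed.

(** * Weight of the elements added by the amalgam *)

Section NormalFormWeight.
Variables (H : set (word d)) (u v w : word d) (L : nat) (c : R).
Hypotheses (sH : is_subgroup H) (luw : leaves H u w) (lvw : leaves H v (finv w)).
Hypothesis rG : reduced (u ++ w ++ finv v).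
Hypotheses (leu : (size u <= L)%N) (lev : (size v <= L)%N).
Hypothesis wH : wbound H c.

(** Allowance for multiplying elements of [H] by [u] or [v] on either side, which shortens them by
    at most L + L. *)
Let kappa := expR (s * (L + L)%:R) * c.

Lemma wbound_fmul (f : word d -> word d) :
  (forall h, H h -> (size h <= size (f h) + (L + L))%N) ->
  wbound [set f h | h in H] kappa.
Proof. exact: wbound_image. Qed.

Lemma wbound_conjugates p : reduced p -> (size p <= L)%N ->
  wbound (conjugates H p) kappa.
Proof.
move=> rp lep; apply: (@wbound_sub _ [set fmul (finv p) (fmul h p) | h in H]).
  by move=> q [h [Hh _ ->]]; exists h.
apply: wbound_fmul => h Hh; have rh := subg_reduced sH Hh.
apply: leq_trans (size_fmull rh rp) _; rewrite addnA leq_add // addnC.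
apply: leq_trans (size_fmulr (finv p) (reduced_fmul h rp)) _.
by rewrite size_finv leq_add2r.
Qed.

(** A loop crosses [w] twice and meets two factors of weight [kappa], so with b = (kappa wt w)^2 a
    bound B for one stage yields b (1 + B) for the next; B = 2 b is preserved because 2 b <= 1. *)
Lemma wbound_loops m : (kappa * wt w) ^+ 2 <= 2^-1 ->
  wbound (loops H u v w m) (2 * (kappa * wt w) ^+ 2).
Proof.
have ru := reduced_catl rG.
have rv : reduced v.
  by have := reduced_finv rG; rewrite !finv_cat finvK -catA => /reduced_catl.
have k0 : 0 <= kappa by rewrite mulr_ge0 ?expR_ge0 // (wbound_ge0 wH).
set b := (kappa * wt w) ^+ 2 => b2; have b0 : 0 <= b by rewrite sqr_ge0.
elim: m => [|m IH] /=; first by apply: wbound0; rewrite mulr_ge0.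
have wVw : wbound [set finv w] (wt w) by rewrite -wt_finv; apply: wbound1.
have wC : wbound [set fmul (finv u) h | h in H] kappa.
  apply: wbound_fmul => h Hh; have rh := subg_reduced sH Hh.
  apply: leq_trans (size_fmulr (finv u) rh) _.
  by rewrite size_finv addnC leq_add2l (leq_trans leu) // leq_addr.
have wS := wbound_cat (wbound1 (p := w))
  (wbound_cat (wbound_conjugates rv lev) wVw).
have := wbound_cat wS
  (wboundU wC (wbound_cat (wbound_conjugates ru leu) IH)).
apply: wbound_le.
have -> : wt w * (kappa * wt w) * (kappa + kappa * (2 * b)) = b * (1 + 2 * b).
  by rewrite /b; ring.
by rewrite mulrC ler_wpM2r //; lra.
Qed.

Lemma wbound_amalg : (kappa * wt w) ^+ 2 <= 2^-1 ->
  wbound (amalg H (u ++ w ++ finv v) `\` H) (kappa * (2 * (kappa * wt w) ^+ 2)).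
Proof.
move=> b2; have ru := reduced_catl rG.
apply: (@wbound_sub _ [set p | exists m,
    catset [set fmul h u | h in H] (loops H u v w m) p]).
  by move=> p [ap nH]; apply: (amalg_loops sH luw lvw rG).
apply: wbound_bigcup => [m n mn p [q Aq [r Lr <-]]|m].
  by exists q => //; exists r => //; apply: loops_mono Lr.
apply: wbound_cat; last exact: wbound_loops.
apply: wbound_fmul => h Hh; have rh := subg_reduced sH Hh.
apply: leq_trans (size_fmull rh ru) _.
by rewrite leq_add2l (leq_trans leu) // leq_addr.
Qed.

End NormalFormWeight.

(** * One approximate return under conjugation by a power *)

Lemma subg_fpow (H : set (word d)) g n : is_subgroup H -> H g -> H (fpow g n).
Proof.
by move=> sH Hg; elim: n => [|n IH] /=; [apply: subg1|apply: subgM].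
Qed.

Lemma fpowM (g : word d) m n : fpow g (m * n) = fpow (fpow g m) n.
Proof. by elim: n => [|n IH]; rewrite ?muln0 // mulnS fpowD IH. Qed.

(** The number [eta] controls the elements outside [H] both in [K] and in its conjugate, so a word
    short enough to weigh more than [eta] is in neither unless it is in [H]. *)
Lemma boomerang_step (H : set (word d)) c g (eta : R) k :
  is_subgroup H -> fin_gen H -> wbound H c -> reduced g -> 0 < eta ->
  exists n K, [/\ is_subgroup K /\ fin_gen K, (k <= n)%N /\ H `<=` K,
    wbound (K `\` H) eta,
    H `<=` conjset (fpow g n) K &
    forall p, reduced p -> conjset (fpow g n) K p -> ~ H p -> wt p <= eta].
Proof.
move=> sH fH wH rg eta0.
have conjE n p : reduced p -> fmul (fmul (finv (fpow g n)) p) (fpow g n) =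
    fmul (finv (fpow g n)) (fmul p (finv (finv (fpow g n)))).
  by move=> rp; rewrite finvK fmulA // reduced_fpow.
have [[m Hm]|/forallNP nH] := pselect (exists m, H (fpow g m.+1)).
  have Hn : H (fpow g (m.+1 * k)) by rewrite fpowM; apply: subg_fpow.
  have HVn := subgV sH Hn.
  exists (m.+1 * k)%N, H; split=> //.
  - by split=> //; rewrite leq_pmull.
  - by rewrite setDv; apply: wbound0; rewrite ltW.
  - by move=> h Hh; rewrite /conjset /=; do 2?apply: subgM.
  - move=> p rp Hp []; have := subgM sH (subgM sH Hn Hp) HVn.
    rewrite conjE // finvK.
    rewrite !fmulA ?fmulVK ?reduced_fmul ?reduced_finv ?reduced_fpow //.
    by rewrite fmulV ?reduced_fpow // fmul0.
have [L LP] := power_escape sH fH rg nH.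
pose kappa := expR (s * (L + L)%:R) * c.
have c1 : 1 <= c.
  by have := wbound_mem wH (subg1 sH); rewrite /wt /wlen mulr0 expR0.
have k1 : 1 <= kappa.
  by rewrite /kappa -[1]mulr1 ler_pM // -expR0 ler_expR mulr_ge0 // ltW.
have k0 : 0 < kappa by apply: lt_le_trans k1.
(* The first term forces kappa wt w <= 1/2, as the loops require; together with it, the second
   brings the total weight below eta. *)
pose eta' := Num.min (2 * kappa)^-1 (eta / (2 * kappa ^+ 2)).
have eta'0 : 0 < eta'.
  rewrite /eta' lt_min; apply/andP; split.
    by rewrite invr_gt0 mulr_gt0.
  by rewrite divr_gt0 // mulr_gt0 // exprn_gt0.
have [N NP] := wt_small eta'0.
have [n [u [v [w [[kn eG kw] leu lev luw lvw]]]]] := LP (maxn k N).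
have rn := reduced_fpow g n.
have rG : reduced (u ++ w ++ finv v) by rewrite -eG reduced_finv.
have rG' : reduced (v ++ finv w ++ finv u).
  by have := reduced_finv rG; rewrite !finv_cat finvK -catA.
have lvw' : leaves H u (finv (finv w)) by rewrite finvK.
have ww : wt w <= eta' by apply: NP; rewrite (leq_trans _ kw) // leq_maxr.
have kw2 : kappa * wt w <= 2^-1.
  apply: le_trans (ler_wpM2l (ltW k0) ww) _.
  have -> : 2^-1 = kappa * (2 * kappa)^-1 by field; lra.
  by rewrite ler_pM2l // /eta' ge_min lexx.
have kw0 : 0 <= kappa * wt w by rewrite mulr_ge0 ?wt_ge0 ?ltW.
have b2 : (kappa * wt w) ^+ 2 <= 2^-1 by nra.
have beta : kappa * (2 * (kappa * wt w) ^+ 2) <= eta.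
  have : kappa * wt w <= eta / (2 * kappa).
    apply: le_trans (ler_wpM2l (ltW k0) ww) _.
    have -> : eta / (2 * kappa) = kappa * (eta / (2 * kappa ^+ 2)) by field; lra.
    by rewrite ler_pM2l // /eta' ge_min lexx orbT.
  have k20 : 0 < 2 * kappa by rewrite mulr_gt0.
  rewrite (ler_pdivlMr _ _ k20) => h1.
  have -> : kappa * (2 * (kappa * wt w) ^+ 2) =
      kappa * wt w * (2 * kappa) * (kappa * wt w).
    by ring.
  apply: le_trans (ler_wpM2r kw0 h1) _.
  by rewrite ler_piMr ?(ltW eta0) //; lra.
exists n, (amalg H (u ++ w ++ finv v)); split.
- by split; [apply: amalg_subgroup|apply: amalg_fin_gen].
- by split; [rewrite (leq_trans _ kn) // leq_maxl|exact: sub_amalg].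
- exact: wbound_le beta (wbound_amalg sH luw lvw rG leu lev wH b2).
- move=> h Hh; rewrite /conjset /= conjE ?(subg_reduced sH) // eG.
  exact: conj_amalg.
(* Conjugated back, [p] lies in <H, g^n H g^-n>: [u] and [v] are exchanged and [w] is inverted,
   which keeps its weight. *)
- move=> p rp; rewrite /conjset /= conjE // eG => ap nHp.
  have := wbound_amalg sH lvw lvw' rG' lev leu wH; rewrite wt_finv => /(_ b2).
  move=> /(wbound_le beta)/wbound_mem; apply; split=> //.
  by have := amalg_conjV sH rG rp ap; rewrite !finv_cat finvK -catA.
Qed.

End Weight.

(** * Iterating the construction *)

Section Construction.
Variables (R : realType) (d : nat) (s : R).
Hypothesis s0 : 0 < s.
Implicit Types (p q g : word d).

(* A subgroup together with a length up to which no later stage changes it. *)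
Definition stage := (set (word d) * nat)%type.

(** The strict inequality leaves room for every later stage under the same [C]. *)
Definition admissible (C : R) (x : stage) :=
  [/\ is_subgroup x.1, fin_gen x.1 & exists2 c, c < C & wbound s x.1 c].

(** The final bound by [y.2] protects the conjugates of short words from later changes, so that the
    return survives in the union. *)
Definition extends g (x y : stage) :=
  [/\ x.1 `<=` y.1, (x.2 < y.2)%N, forall p, y.1 p -> (size p <= x.2)%N -> x.1 p
   & exists n, [/\ (x.2 <= n)%N, x.1 `<=` conjset (fpow g n) y.1
     & forall p, reduced p -> (size p <= x.2)%N ->
         (conjset (fpow g n) y.1 p -> x.1 p) /\
         (size (fmul (fmul (finv (fpow g n)) p) (fpow g n)) <= y.2)%N]].

Lemma extension C g x : reduced g -> admissible C x ->
  exists2 y, admissible C y & extends g x y.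
Proof.
case: x => H T rg [/= sH fH [c cC wH]].
(* The first term keeps the total below [C]; the second is less than the weight of any word of
   length at most [T]. *)
pose eta := Num.min ((C - c) / 2) (expR (- s * T%:R) / 2).
have eta0 : 0 < eta.
  by rewrite /eta lt_min !divr_gt0 ?subr_gt0 ?expR_gt0.
have short p : (size p <= T)%N -> ~ wt s p <= eta.
  move=> pT; have : expR (- s * T%:R) <= wt s p.
    by rewrite ler_expR !mulNr lerN2 ler_pM2l // ler_nat.
  have : eta <= expR (- s * T%:R) / 2 by rewrite /eta ge_min lexx orbT.
  by have := expR_gt0 (- s * T%:R); lra.
have [n [K [[sK fK] [Tn HK] wK Hn Kn]]] := boomerang_step s0 T sH fH wH rg eta0.
(* This length exceeds [T] and bounds g^-n p g^n for every [p] of length at most [T]. *)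
exists (K, T.+1 + (size (fpow g n) + size (fpow g n)))%N.
  split=> //=; exists (c + eta).
    have : eta <= (C - c) / 2 by rewrite /eta ge_min lexx.
    by lra.
  apply: wbound_sub (wboundU wH wK) => p Kp.
  by have [Hp|nHp] := pselect (H p); [left|right].
split=> //=; first by rewrite addSn ltnS leq_addr.
  move=> p Kp pT; apply: contrapT => nHp.
  by apply: (short p pT); apply: wbound_mem wK _.
exists n; split=> // p rp pT; split.
  by move=> Kp; apply: contrapT => nHp; apply: (short p pT); apply: Kn.
apply: leq_trans (size_fmul _ _) _; rewrite addnA leq_add2r.
apply: leq_trans (size_fmul _ _) _; rewrite size_finv addnC leq_add2r.
exact: leqW.
Qed.

(** The 2-adic valuation of [k] encodes the word, so each reduced word occurs infinitely often;
    other codes default to the empty word. *)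
Definition enum_word k : word d :=
  let g := odflt [::] (unpickle (logn 2 k)) in if reduced g then g else [::].

Lemma reduced_enum_word k : reduced (enum_word k).
Proof. by rewrite /enum_word; case: ifP. Qed.

Lemma enum_word_cofinal g N : reduced g -> exists2 k, (N <= k)%N & enum_word k = g.
Proof.
(* The odd cofactor makes the index large without altering its valuation. *)
move=> rg; exists (2 ^ pickle g * (N.*2).+1)%N.
  apply: (@leq_trans (N.*2).+1); first by rewrite -addnn -addnS leq_addr.
  by rewrite leq_pmull // expn_gt0.
rewrite /enum_word lognM ?expn_gt0 // pfactorK // logn_coprime ?addn0; last first.
  by rewrite coprime2n /= odd_double.
by rewrite pickleK /= rg.
Qed.

Lemma boomerang_extension (G : set (word d)) c T :
  is_subgroup G -> fin_gen G -> wbound s G c ->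
  exists D, [/\ boomerang D, G `<=` D, forall p, D p -> (size p <= T)%N -> G p
    & wbound s D (c + 1)].
Proof.
move=> sG fG wG.
have a0 : admissible (c + 1) (G, T) by split=> //; exists c => //; rewrite ltrDl.
(* Admissibility is packed into the type so that choice gives a function to iterate. *)
pose X := {x : stage | admissible (c + 1) x}.
have /choice[f fP] : forall kx : nat * X, exists y : X,
    extends (enum_word kx.1) (sval kx.2) (sval y).
  move=> [k [x ax]] /=.
  by have [y ay xy] := extension (reduced_enum_word k) ax; exists (exist _ y ay).
pose x k : X := iteri k (fun i y => f (i, y)) (exist _ _ a0).
pose H k := (sval (x k)).1; pose L k := (sval (x k)).2.
have sH k : is_subgroup (H k) by rewrite /H; case: (x k) => y [].
have wH k : wbound s (H k) (c + 1).
  rewrite /H; case: (x k) => y [_ _ [c' cc']] /=.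
  by apply: wbound_le; apply: ltW.
have step k : extends (enum_word k) (H k, L k) (H k.+1, L k.+1).
  by have := fP (k, x k); rewrite /H /L; case: (sval (x k)); case: (sval (x k.+1)).
have Hmono m n : (m <= n)%N -> H m `<=` H n.
  move=> /subnK <-; elim: (n - m)%N => // i IH p /IH; rewrite addSn.
  by case: (step (i + m)%N) => + _ _ _; apply.
have Lmono m n : (m <= n)%N -> (L m <= L n)%N.
  move=> /subnK <-; elim: (n - m)%N => // i IH; rewrite addSn.
  by case: (step (i + m)%N) => _ /= /ltnW + _ _; apply: leq_trans.
have Lge k : (k <= L k)%N.
  by elim: k => // k IH; case: (step k) => _ /= + _ _; apply: leq_ltn_trans.
have stable k j p : H j p -> (size p <= L k)%N -> H k p.
  move=> Hj pL; have [/Hmono|/ltnW kj] := leqP j k; first by apply.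
  move: Hj; rewrite -(subnK kj); elim: (j - k)%N => // i IH; rewrite addSn => Hp.
  apply: IH; case: (step (i + k)%N) => _ _ /= + _; apply => //.
  by rewrite (leq_trans pL) // Lmono // leq_addl.
pose D : set (word d) := [set p | exists k, H k p].
have sD : is_subgroup D.
  split=> [p [k /(subg_reduced (sH k))]|] //; split; first by exists 0%N; apply: subg1.
  split=> [p q [k Hp] [j Hq]|p [k Hp]]; last by exists k; apply: subgV.
  exists (maxn k j); apply: subgM => //.
    by apply: Hmono Hp; rewrite leq_maxl.
  by apply: Hmono Hq; rewrite leq_maxr.
exists D; split.
- split=> // g rg.
  (* Returns exact on the ball of radius [N], one for each [N], make up the required sequence. *)
  suff /choice[n nP] : forall N, exists n, (N <= n)%N /\ forall p, reduced p ->
      (size p <= N)%N -> (conjset (fpow g n) D p <-> D p).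
    exists n; split=> [N|p rp].
      by exists N => k Nk; apply: leq_trans Nk _; case: (nP k).
    by exists (size p) => k pk; case: (nP k) => _; apply.
  move=> N; have [k Nk eg] := enum_word_cofinal N rg.
  have [_ _ _ [n [/= Ln Hn Kn]]] := step k; rewrite eg in Hn Kn.
  have NL : (N <= L k)%N by apply: leq_trans Nk (Lge k).
  exists n; split=> [|p rp pN]; first exact: leq_trans NL Ln.
  have pL := leq_trans pN NL; have [Kp Lp] := Kn p rp pL.
  (* Membership in [D] of g^-n p g^n is settled at stage k + 1 and that of [p] at stage k, by their
     lengths. *)
  split=> [[j Hj]|[j Hj]]; last by exists k.+1; apply: Hn; apply: stable Hj pL.
  by exists k; apply: Kp; apply: stable Hj Lp.
- by move=> p Gp; exists 0%N.
- by move=> p [j Hj] pT; apply: (stable 0%N j).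
- exact: wbound_bigcup.
Qed.

Lemma wbound_esum (A : set (word d)) c : wbound s A c ->
  (\esum_(g in A) (expR (- s * (wlen g)%:R))%:E <= c%:E)%E.
Proof.
move=> wA; apply: ge_ereal_sup => _ [F [finF FA] <-].
rewrite fsbig_finite //= sumEFin lee_fin; apply: wA; first exact: finmap.fset_uniq.
by move=> p; rewrite in_fset_set // inE => /FA.
Qed.

Lemma esum_wbound (A : set (word d)) :
  (\esum_(g in A) (expR (- s * (wlen g)%:R))%:E < +oo)%E -> exists c, wbound s A c.
Proof.
move=> foo; have fin : (\esum_(g in A) (expR (- s * (wlen g)%:R))%:E)%E \is a fin_num.
  rewrite ge0_fin_numE //; apply: esum_ge0 => g _.
  by rewrite lee_fin expR_ge0.
exists (fine (\esum_(g in A) (expR (- s * (wlen g)%:R))%:E)) => l ul lA.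
rewrite -lee_fin fineK // -sumEFin fsbig_seq //.
apply: ereal_sup_ubound; exists [set` l] => //; split=> //.
exact: finite_seq.
Qed.

Lemma critexp_le (A : set (word d)) c : wbound s A c -> (critexp R A <= s%:E)%E.
Proof.
move=> wA; apply: ereal_inf_lbound; exists s => //; split=> //.
by apply: le_lt_trans (wbound_esum wA) _; rewrite ltry.
Qed.

End Construction.

(** * Critical exponents: monotonicity and finiteness *)

Section CriticalExponent.
Variables (R : realType) (d : nat).
Implicit Types (A B : set (word d)).

Lemma critexp_sub A B : A `<=` B -> (critexp R A <= critexp R B)%E.
Proof.
move=> AB; apply: ereal_inf_le_tmp => _ [s [s0 /esum_wbound[c wB]] <-].
exists s => //; split=> //.
have /wbound_esum : wbound s A c by apply: wbound_sub wB.
by move=> /le_lt_trans; apply; rewrite ltry.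
Qed.

Lemma critexp_lt A (x : \bar R) : (critexp R A < x)%E ->
  exists s c, [/\ 0 < s, wbound s A c & (s%:E < x)%E].
Proof.
move=> /ereal_inf_lt[_ [s [s0 /esum_wbound[c wA]] <-] sx].
by exists s, c.
Qed.

Lemma critexp_ge0 A : (0 <= critexp R A)%E.
Proof.
by apply: le_ereal_inf_tmp => _ [s [s0 _] <-]; rewrite lee_fin ltW.
Qed.

(** When the letters weigh at most 1/2 in total, all words together are dominated by a geometric
    series of sum 2. This makes every critical exponent finite. *)
Lemma wbound_setT : exists2 s : R, 0 < s & wbound s [set: word d] 2.
Proof.
(* With s = 2 N + 1, exp s >= 1 + s gives N exp (- s) <= 1/2. *)
pose N := #|{: letter d}|; pose s : R := (2 * N)%:R + 1.
have s0 : 0 < s by rewrite ltr_wpDl // ler0n.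
exists s => //.
have eN : N%:R * expR (- s) <= 2^-1.
  rewrite expRN -ler_pdivlMr ?invr_gt0 ?expR_gt0 // invrK.
  have := expR_ge1Dx s; rewrite {1}/s natrM; lra.
have wL : wbound s [set p : word d | size p = 1%N] 2^-1.
  move=> l ul lA.
  have -> : \sum_(p <- l) wt s p = (size l)%:R * expR (- s).
    rewrite big_seq (eq_bigr (fun=> expR (- s))); last first.
      by move=> p /lA /= p1; rewrite /wt /wlen p1 mulr1.
    by rewrite -big_seq big_const_seq count_predT iter_addr_0 mulr_natl.
  apply: le_trans eN; rewrite ler_pM2r ?expR_gt0 // ler_nat.
  have -> : N = size [seq [:: x] | x <- enum {: letter d}] by rewrite size_map -cardE.
  apply: uniq_leq_size => // p /lA; case: p => [|x [|]] //= _.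
  by apply/mapP; exists x; rewrite // mem_enum.
pose F n := [set p : word d | (size p <= n)%N].
apply: (@wbound_sub _ _ _ _ [set p | exists n, F n p]).
  by move=> p _; exists (size p); rewrite /F /=.
apply: wbound_bigcup => [m n mn p /leq_trans|n]; first exact.
elim: n => [|n IH].
  apply: (@wbound_le _ _ _ _ (wt s [::])).
    by rewrite /wt /wlen mulr0 expR0; lra.
  by apply: wbound_sub (@wbound1 R d s [::]) => p; rewrite /F /= leqn0 size_eq0 => /eqP.
have := wboundU (@wbound1 R d s [::]) (wbound_cat wL IH).
have -> : wt s ([::] : word d) + 2^-1 * 2 = 2.
  by rewrite /wt /wlen mulr0 expR0; field.
apply: wbound_sub => -[|x p]; rewrite /F /=; first by left.
by rewrite ltnS => pn; right; exists [:: x] => //; exists p.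
Qed.

End CriticalExponent.

Theorem theorem1p2 (R : realType) (d : nat) (Gamma : set (word d))
  (O : set (set (word d))) (eps : R) :
  is_subgroup Gamma -> fin_gen Gamma -> chab_nbhd Gamma O -> 0 < eps ->
  exists Delta : set (word d),
    boomerang Delta /\ O Delta /\
    (critexp R Gamma <= critexp R Delta)%E /\
    (critexp R Delta <= critexp R Gamma + eps%:E)%E.
Proof.
move=> sG fG [S SO] eps0.
(* Finiteness makes adding [eps] a strict increase, leaving space for a convergent exponent [s] in
   between. *)
have finG : critexp R Gamma \is a fin_num.
  rewrite ge0_fin_numE ?critexp_ge0 //; have [t t0 wT] := wbound_setT R d.
  have := critexp_le t0 (wbound_sub (@subsetT _ Gamma) wT).
  by move=> /le_lt_trans; apply; rewrite ltry.
have : (critexp R Gamma < critexp R Gamma + eps%:E)%E by rewrite lteDl // lte_fin.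
move=> /critexp_lt[s [c [s0 wG ls]]].
(* The ball of this radius contains all the words that test membership in [O]. *)
have [D [bD GD DG wD]] :=
  boomerang_extension s0 (\max_(g <- S) size g)%N sG fG wG.
exists D; split=> //; split.
  apply: SO => [|g gS]; first by case: bD.
  split=> [/DG|/GD] //; apply.
  by apply: leq_bigmax_seq.
split; first exact: critexp_sub.
by apply: le_trans (critexp_le s0 wD) _; apply: ltW.
Qed.
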